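(* Let $n\ge 1$ and let $(a,b)$ be a finite or infinite open interval of $\mathbb{R}$. Let $\mathcal{G}_n$, $\mathcal{P}_n$, $\mathcal{Q}_{n+1}$ be monic real polynomials of degrees $n$, $n$, $n+1$, respectively, all of whose zeros are real and lie in $(a,b)$. Denote the zeros of $\mathcal{G}_n$ and $\mathcal{P}_n$ in ascending order by $\{x_{k,n}\}_{k=1}^n$ and $\{z_{k,n}\}_{k=1}^n$, respectively. Assume that $\mathcal{Q}_{n+1}\prec\mathcal{G}_n$ and that $$A(x)\mathcal{P}_n(x)=B(x)\mathcal{G}_n(x)-(x-E)\mathcal{Q}_{n+1}(x),$$ where $E\in\mathbb{R}$, $A$ and $B$ are real-valued functions continuous on $(a,b)$ (with $B$ also defined at $E$), and $A(x)>0$ on $(a,b)$. Assume also that $B(E)\neq 0$ and that $\mathcal{G}_n$ and $\mathcal{P}_n$ have no common zeros. Then at least $n-2$ zeros of $\mathcal{P}_n$ lie in distinct intervals whose endpoints are consecutive zeros of $\mathcal{G}_n$ (i.e. at least $n-2$ of the intervals $(x_{k,n},x_{k+1,n})$, $1\le k\le n-1$, contain a zero of $\mathcal{P}_n$). Moreover: 1. $(x-E)\mathcal{G}_n(x)\prec\mathcal{P}_n(x)$ whenever $x_{k',n}<z_{k',n}<E<z_{k'+1,n}<x_{k'+1,n}$ for some $k'\in\{1,2,\dots,n-1\}$. 2. $\mathcal{P}_n\prec\mathcal{G}_n$ whenever $E<x_{1,n}$, and $\mathcal{G}_n\prec\mathcal{P}_n$ whenever $E>x_{n,n}$.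
   Context: Notation $\prec$ for real polynomials $p,q$ with real and distinct zeros: - If $\deg p=\deg q=m$, with zeros $x_1<\dots<x_m$ of $p$ and $y_1<\dots<y_m$ of $q$, then $p\prec q$ means $x_1<y_1<x_2<y_2<\cdots<y_{m-1}<x_m<y_m$. - If $\deg p=m$ and $\deg q=m-1$, with zeros $x_1<\dots<x_m$ of $p$ and $y_1<\dots<y_{m-1}$ of $q$, then $p\prec q$ means $x_1<y_1<x_2<y_2<\cdots<y_{m-1}<x_m$. In particular, $p\prec q$ includes the assertion that the zeros of $p$ and of $q$ are real and distinct. The displayed identity is assumed to hold for all $x\in(a,b)$. *)

(* Defs.v *)
From HB Require Import structures.
From mathcomp Require Import all_boot all_order all_algebra.
From mathcomp Require Import all_classical all_reals all_analysis.

Set Implicit Arguments.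
Unset Strict Implicit.
Unset Printing Implicit Defensive.

Import Order.TTheory GRing.Theory Num.Theory.
Import numFieldNormedType.Exports.
Local Open Scope classical_set_scope.
Local Open Scope ring_scope.

(* The bounds are extended reals, so that (a, b) may be infinite. *)
Definition open_interval (R : realType) (a b : \bar R) : set R :=
  [set t : R | (a < t%:E < b)%E].

(* All the zeros of p are real, and s lists them in ascending order, repeated
   according to their multiplicities. Zeros are numbered from 0. *)
Definition zeros_of (R : realType) (p : {poly R}) (s : seq R) : Prop :=
  [/\ p != 0,
      sorted <=%R s
    & p = lead_coef p *: \prod_(t <- s) ('X - t%:P)].

(* The relation p \prec q. By zeros_of, size xs and size ys are the degrees of
   p and q. *)
Definition prec (R : realType) (p q : {poly R}) : Prop :=
  exists xs ys : seq R,
    [/\ zeros_of p xs /\ sorted <%R xs,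
        zeros_of q ys /\ sorted <%R ys
      & [/\ size xs = size ys,
            forall i, (i < size xs)%N -> xs`_i < ys`_i
          & forall i, (i.+1 < size xs)%N -> ys`_i < xs`_i.+1]
        \/
        (size xs = (size ys).+1 /\
         forall i, (i < size ys)%N -> xs`_i < ys`_i < xs`_i.+1)].

(* Main.v *)
(* Let d(t) be the number of zeros of P below t. At a zero x_k of G the identity
   reads A P = - (x_k - E) Q, and since Q has exactly k + 1 zeros below x_k,
   comparing signs gives d(x_k) = k + [E < x_k] mod 2. Hence d increases
   strictly from x_k to x_(k+1) unless E lies between them, and 0 <= d <= n
   then determines every d(x_k) in each of the three configurations. *)

Require Import Defs.
From HB Require Import structures.
From mathcomp Require Import all_boot all_order all_algebra.
From mathcomp Require Import all_classical all_reals all_analysis.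
From mathcomp Require Import ring zify.

Set Implicit Arguments.
Unset Strict Implicit.
Unset Printing Implicit Defensive.

Import Order.TTheory GRing.Theory Num.Theory.
Import numFieldNormedType.Exports.
Local Open Scope classical_set_scope.
Local Open Scope ring_scope.

(** * Zero counts below a point and signs of monic real-rooted polynomials *)

Definition count_below (R : realType) (s : seq R) (t : R) : nat :=
  count (fun u => u < t) s.

Lemma count_below_homo (R : realType) (s : seq R) :
  {homo count_below s : t u / t <= u >-> (t <= u)%N}.
Proof. by move=> t u le_tu; apply: sub_count => v /= /lt_le_trans; apply. Qed.

(** In an ascending list the entries below [t] form a prefix, so a comparison of reals becomes a
    comparison of indices. *)
Lemma nth_lt_count_below (R : realType) (s : seq R) (t : R) (i : nat) :
  sorted <=%R s -> (i < size s)%N -> (s`_i < t) = (i < count_below s t)%N.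
Proof.
elim: s i => [|v s IHs] // i /= path_s; rewrite /count_below /=.
have sorted_s := path_sorted path_s.
have [lt_vt|le_tv] := ltP v t.
  by case: i => [|i] //= lt_i; rewrite IHs // add1n ltnS.
have s_ge_t : {in s, forall u, (u < t) = false}.
  move=> u us; apply/negbTE; rewrite -leNgt (le_trans le_tv) //.
  by move/allP: (order_path_min le_trans path_s); apply.
have -> : count (fun u => u < t) s = 0%N.
  by rewrite (eq_in_count s_ge_t) count_pred0.
rewrite addn0 ltn0 => lt_i.
case: i lt_i => [|i] lt_i /=; first by rewrite ltNge le_tv.
by rewrite s_ge_t ?mem_nth.
Qed.

Lemma count_below_eq (R : realType) (s : seq R) (t u : R) :
  t <= u -> t \notin s -> ~~ has (fun v => t < v < u) s ->
  count_below s t = count_below s u.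
Proof.
move=> le_tu ts /hasPn no_s; apply: eq_in_count => v vs.
have /= := no_s v vs.
case: (ltgtP v t) => [lt_vt|//|eq_vt]; last by rewrite -eq_vt vs in ts.
by rewrite (lt_le_trans lt_vt).
by move=> _ /= /negbTE.
Qed.

(** Each entry above [t] contributes a factor -1. The number of such entries is a difference; the
    sum in the exponent has the same parity and avoids truncated subtraction. *)
Lemma sgr_prod_sub (R : realType) (s : seq R) (t : R) : t \notin s ->
  Num.sg (\prod_(u <- s) (t - u)) = (-1) ^+ (size s + count_below s t).
Proof.
rewrite /count_below; elim: s => [|v s IHs] /=.
  by rewrite big_nil sgr1 expr0.
rewrite inE negb_or => /andP[neq_tv /IHs IH].
rewrite big_cons sgrM IH.
case: (ltgtP v t) neq_tv => // [lt_vt|lt_tv] _.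
  by rewrite gtr0_sg ?subr_gt0 // mul1r addSnnS !addnS !exprS; ring.
by rewrite ltr0_sg ?subr_lt0 // add0n addSn exprS.
Qed.

Lemma size_zeros_of (R : realType) (p : {poly R}) (s : seq R) :
  zeros_of p s -> size p = (size s).+1.
Proof.
by case=> p_neq0 _ ->; rewrite size_scale ?lead_coef_eq0 // size_prod_XsubC.
Qed.

Lemma root_zeros_of (R : realType) (p : {poly R}) (s : seq R) (t : R) :
  zeros_of p s -> root p t = (t \in s).
Proof.
by case=> p_neq0 _ ->; rewrite rootZ ?lead_coef_eq0 // root_prod_XsubC.
Qed.

Lemma sgr_horner_zeros_of (R : realType) (p : {poly R}) (s : seq R) (t : R) :
  p \is monic -> zeros_of p s -> t \notin s ->
  Num.sg p.[t] = (-1) ^+ (size s + count_below s t).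
Proof.
move=> /monicP lead_p [_ _ ->] /sgr_prod_sub <-.
rewrite lead_p scale1r horner_prod; congr Num.sg.
by apply: eq_bigr => u _; rewrite hornerXsubC.
Qed.

(** This identifies a given list of zeros with the one provided existentially by [prec]. Both lists
    have the same members and the same length, so the absence of repetitions passes from [s'] to
    [s]. *)
Lemma zeros_of_strict_unique (R : realType) (p : {poly R}) (s s' : seq R) :
  zeros_of p s -> zeros_of p s' -> sorted <%R s' -> s = s'.
Proof.
move=> ps ps' sorted_s'.
have uniq_s' : uniq s' := lt_sorted_uniq sorted_s'.
have eq_mem : s =i s'.
  by move=> t; rewrite -(root_zeros_of t ps) (root_zeros_of t ps').
have size_eq : size s = size s'.
  by apply: succn_inj; rewrite -(size_zeros_of ps) -(size_zeros_of ps').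
have uniq_s : uniq s by rewrite (eq_uniq size_eq).
case: ps => _ sorted_s _; apply: (sorted_eq le_trans le_anti sorted_s).
  by rewrite lt_sorted_uniq_le in sorted_s'; case/andP: sorted_s'.
exact: uniq_perm.
Qed.

Lemma strict_sorted_nth (R : realType) (s : seq R) :
  (forall i, (i.+1 < size s)%N -> s`_i < s`_i.+1) -> sorted <%R s.
Proof. by move=> lt_s; apply/(sortedP 0) => i; apply: lt_s. Qed.

Lemma zeros_of_mul_XsubC (R : realType) (p : {poly R}) (s1 s2 : seq R) (t : R) :
  p \is monic -> zeros_of p (s1 ++ s2) -> sorted <=%R (s1 ++ t :: s2) ->
  zeros_of (('X - t%:P) * p) (s1 ++ t :: s2).
Proof.
move=> monic_p [p_neq0 _ eq_p] sorted_s.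
have monic_m : ('X - t%:P) * p \is monic by rewrite monicMl // monicXsubC.
split=> //; first exact: monic_neq0.
rewrite (monicP monic_m) scale1r {1}eq_p (monicP monic_p) scale1r.
by rewrite !big_cat big_cons /= mulrCA.
Qed.

(* This is f i - i <= f j - j, written so as to avoid truncated subtraction. *)
Lemma steps_leq (f : nat -> nat) (i j : nat) : (i <= j)%N ->
  (forall k, (i <= k < j)%N -> (f k < f k.+1)%N) -> (f i + j <= f j + i)%N.
Proof.
elim: j => [|j IHj]; first by rewrite leqn0 => /eqP ->.
rewrite leq_eqVlt => /predU1P[->|] //; rewrite ltnS => le_ij lt_f.
have := lt_f j; rewrite le_ij ltnSn => /(_ isT) lt_fj.
have : (f i + j <= f j + i)%N.
  by apply: IHj => // k /andP[le_ik lt_kj]; rewrite lt_f // le_ik ltnS ltnW.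
by lia.
Qed.

(** The difference [f l - l] does not decrease on [[i, j]], starts at [c] or above and ends at [c]
    or below, so it equals [c] throughout. *)
Lemma steps_eq (f : nat -> nat) (c i j k : nat) : (i <= k <= j)%N ->
  (forall l, (i <= l < j)%N -> (f l < f l.+1)%N) ->
  (i + c <= f i)%N -> (f j <= j + c)%N -> f k = (k + c)%N.
Proof.
move=> /andP[le_ik le_kj] lt_f le_fi le_fj.
have : (f i + k <= f k + i)%N.
  by apply: steps_leq => // l ltl; apply: lt_f; lia.
have : (f k + j <= f j + k)%N.
  by apply: steps_leq => // l ltl; apply: lt_f; lia.
by lia.
Qed.

Lemma size_insert (T : Type) (s : seq T) (t : T) (k : nat) :
  (k <= size s)%N -> size (take k s ++ t :: drop k s) = (size s).+1.
Proof. by move=> le_k; rewrite size_cat /= size_takel ?size_drop //; lia. Qed.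

Lemma nth_insert (T : Type) (t0 : T) (s : seq T) (t : T) (k i : nat) :
  (k <= size s)%N -> nth t0 (take k s ++ t :: drop k s) i =
  if (i < k)%N then nth t0 s i else if i == k then t else nth t0 s i.-1.
Proof.
move=> le_k; rewrite nth_cat size_takel //.
case: ltnP => [lt_ik|le_ki]; first by rewrite nth_take.
case: eqP => [->|neq_i]; first by rewrite subnn.
have -> : (i - k = (i - k.+1).+1)%N by lia.
by rewrite /= nth_drop; congr nth; lia.
Qed.

Lemma count_below_between (R : realType) (s : seq R) (t : R) (k : nat) :
  sorted <=%R s -> (k.+1 < size s)%N -> s`_k < t < s`_k.+1 ->
  count_below s t = k.+1 /\ t \notin s.
Proof.
move=> sorted_s lt_k1 /andP[lt_st lt_ts].
have lt_nth i : (i < size s)%N -> (s`_i < t) = (i < count_below s t)%N.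
  exact: nth_lt_count_below.
have below_s : count_below s t = k.+1.
  have := lt_nth _ (ltnW lt_k1); have := lt_nth _ lt_k1.
  by rewrite lt_st [s`_k.+1 < _]ltNge (ltW lt_ts) /=; lia.
split=> //; apply/negP => /(nthP 0)[j lt_j eq_j].
have := lt_nth _ lt_j; rewrite eq_j ltxx below_s => /esym/negbT.
rewrite -leqNgt => lt_kj.
have : s`_k.+1 <= s`_j by apply: le_sorted_leq_nth.
by rewrite eq_j leNgt lt_ts.
Qed.

(** Both sides of the identity have the same sign at [t]. The negation comes from the extra degree
    of [Q], and [E < t] from the sign of [-(t - E)]. *)
Lemma odd_count_below (R : realType) (P Q : {poly R}) (z y : seq R) (A E t : R) :
  P \is monic -> Q \is monic -> zeros_of P z -> zeros_of Q y ->
  size y = (size z).+1 -> t \notin z -> t \notin y -> 0 < A ->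
  A * P.[t] = - ((t - E) * Q.[t]) ->
  odd (count_below z t) = ~~ odd (count_below y t) (+) (E < t).
Proof.
move=> monP monQ zP yQ sy tz ty A_gt0 eq_t.
have sg_tE : Num.sg (- (t - E)) = (-1) ^+ (E < t)%R.
  have [lt_tE|lt_Et|eq_tE] := ltgtP t E.
  - by rewrite gtr0_sg ?expr0 // opprB subr_gt0.
  - by rewrite ltr0_sg ?expr1 // opprB subr_lt0.
  (* If [t = E], the right side of the identity vanishes, and [A > 0] makes [t] a zero of [P]. *)
  case/negP: tz; rewrite -(root_zeros_of _ zP); apply/rootP.
  move/eqP: eq_t; rewrite eq_tE subrr mul0r oppr0 mulf_eq0 (gt_eqF A_gt0).
  by move=> /eqP.
have := congr1 Num.sg eq_t; rewrite -mulNr !sgrM (gtr0_sg A_gt0) mul1r sg_tE.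
rewrite (sgr_horner_zeros_of monP zP tz) (sgr_horner_zeros_of monQ yQ ty) sy.
rewrite -[LHS]signr_odd -[X in _ * X]signr_odd -signr_addb => /signr_inj.
rewrite addSn /= !oddD.
by do 3 case: odd; case: (E < t).
Qed.

Theorem theorem2p3 (R : realType) (n : nat) (a b : \bar R)
    (G P Q : {poly R}) (x z y : seq R) (A B : R -> R) (E : R)
    (n_ge1 : (1 <= n)%N)
    (lt_ab : (a < b)%E)
    (monicG : G \is monic) (sizeG : size G = n.+1)
    (monicP : P \is monic) (sizeP : size P = n.+1)
    (monicQ : Q \is monic) (sizeQ : size Q = n.+2)
    (zerosG : zeros_of G x)
    (zerosP : zeros_of P z)
    (zerosQ : zeros_of Q y)
    (G_ab : forall t : R, root G t -> open_interval a b t)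
    (P_ab : forall t : R, root P t -> open_interval a b t)
    (Q_ab : forall t : R, root Q t -> open_interval a b t)
    (precQG : prec Q G)
    (contA : {within open_interval a b, continuous A})
    (contB : {within open_interval a b, continuous B})
    (A_gt0 : forall t : R, open_interval a b t -> 0 < A t)
    (identity : forall t : R, open_interval a b t ->
      A t * P.[t] = B t * G.[t] - (t - E) * Q.[t])
    (BE_neq0 : B E != 0)
    (no_common_zero : forall t : R, ~ (root G t /\ root P t)) :
  [/\ (n - 2 <=
        #|[pred k : 'I_n.-1 | has (fun t : R => (x`_k < t < x`_k.+1)%R) z]|)%N,
      (exists k : nat, (k.+1 < n)%N /\
          [/\ x`_k < z`_k, z`_k < E, E < z`_k.+1 & z`_k.+1 < x`_k.+1]) ->
        prec (('X - E%:P) * G) P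
    & (E < x`_0 -> prec P G) /\ (x`_n.-1 < E -> prec G P)].
Proof.

(* Parity and growth of the counts [d k] *)
case: precQG => ys [xs [[zQ sorted_ys] [zG sorted_xs] inter]].
have x_xs := zeros_of_strict_unique zerosG zG sorted_xs; subst xs.
have size_ys : size ys = n.+1 by apply: succn_inj; rewrite -(size_zeros_of zQ).
have size_x : size x = n by apply: succn_inj; rewrite -(size_zeros_of zG).
have size_z : size z = n by apply: succn_inj; rewrite -(size_zeros_of zerosP).
have {}inter i : (i < n)%N -> ys`_i < x`_i < ys`_i.+1.
  case: inter => [[eq_size]|[_ inter]]; last by rewrite -size_x; apply: inter.
  by move: eq_size; rewrite size_ys size_x => /eqP; rewrite eqn_leq ltnn.
have sorted_z : sorted <=%R z by case: zerosP.
have x_lt i j : (i < j)%N -> (j < n)%N -> x`_i < x`_j.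
  move=> lt_ij lt_jn.
  by rewrite (lt_sorted_ltn_nth 0 sorted_xs) ?inE ?size_x // (ltn_trans lt_ij).
have root_x k : (k < n)%N -> root G x`_k.
  by move=> lt_kn; rewrite (root_zeros_of _ zG) mem_nth ?size_x.
have xz k : (k < n)%N -> x`_k \notin z.
  move=> /root_x rGx; apply/negP; rewrite -(root_zeros_of _ zerosP) => rPx.
  exact: no_common_zero (conj rGx rPx).
pose d k := count_below z x`_k.
have d_le k : (d k <= n)%N by rewrite -size_z count_size.
have odd_d k : (k < n)%N -> odd (d k) = odd k (+) (E < x`_k).
  move=> lt_kn; have sorted_le_ys : sorted <=%R ys by case: zQ.
  have lt_k : (k.+1 < size ys)%N by rewrite size_ys.
  have [below_ys x_ys] := count_below_between sorted_le_ys lt_k (inter k lt_kn).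
  have abx := G_ab _ (root_x k lt_kn).
  have -> : odd k = ~~ odd (count_below ys x`_k) by rewrite below_ys /= negbK.
  apply: (odd_count_below monicP monicQ zerosP zQ _ (xz k lt_kn) x_ys
            (A_gt0 _ abx)).
    by rewrite size_ys size_z.
  by rewrite (identity _ abx) (rootP (root_x k lt_kn)) mulr0 sub0r.
have d_step k : (k.+1 < n)%N -> (E < x`_k) = (E < x`_k.+1) -> (d k < d k.+1)%N.
  move=> lt_kn eqE; rewrite ltn_neqAle count_below_homo ?andbT; last first.
    by rewrite ltW // x_lt.
  (* Equal counts would have equal parity, but [k] and [k.+1] differ in parity while the
     contributions of [E] agree. *)
  apply/eqP => eq_d; move: (odd_d k.+1 lt_kn) (odd_d k (ltnW lt_kn)).
  by rewrite eq_d eqE /= => ->; case: odd; case: (E < _).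
have z_lt i k : (i < n)%N -> (z`_i < x`_k) = (i < d k)%N.
  by move=> lt_in; apply: nth_lt_count_below; rewrite ?size_z.
(* The inequality is strict because [x_k] is not a zero of [P]. *)
have z_gt i k : (i < n)%N -> (k < n)%N -> (x`_k < z`_i) = (d k <= i)%N.
  move=> lt_in lt_kn; rewrite leqNgt -z_lt // -leNgt lt_neqAle andb_idl // => _.
  by apply: contraNneq (xz k lt_kn) => ->; rewrite mem_nth ?size_z.
split.

(* Gaps between zeros of [G] that contain no zero of [P] *)
- pose p := [pred k : 'I_n.-1 | has (fun t => x`_k < t < x`_k.+1) z].
  have lt_gap (k : 'I_n.-1) : (k.+1 < n)%N by rewrite -ltn_predRL.
  (* The count does not change across such a gap, so by [d_step] the truth value of [E < x_k] must
     change there. *)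
  have E_gap (k : 'I_n.-1) : k \notin p -> x`_k <= E < x`_k.+1.
    rewrite inE /= => no_z; have lt_kn := lt_gap k.
    have eq_d : d k = d k.+1.
      by apply: count_below_eq no_z; [apply/ltW/x_lt|apply/xz/ltnW].
    case: (ltP E x`_k) => [lt_E|_].
      have := d_step k lt_kn.
      by rewrite lt_E (lt_trans lt_E) ?x_lt // eq_d ltnn => /(_ erefl).
    rewrite ltNge; apply/negP => le_E.
    have := d_step k lt_kn; rewrite eq_d ltnn ![E < _]ltNge le_E.
    by rewrite (le_trans (ltW (x_lt _ _ (ltnSn k) lt_kn)) le_E) => /(_ erefl).
  (* The half-open gaps are disjoint, so [E] lies in at most one of them; hence at most one of the
     [n - 1] gaps is missed. *)
  have : (#|[predC p]| <= 1)%N.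
    apply/card_le1_eqP => i j /E_gap/andP[le_i lt_i] /E_gap/andP[le_j lt_j].
    have lt_in : (i < n)%N := ltnW (lt_gap i).
    have lt_jn : (j < n)%N := ltnW (lt_gap j).
    apply/val_inj => /=.
    have x_le k l : (k < l)%N -> (l < n)%N -> x`_k.+1 <= x`_l.
      by rewrite leq_eqVlt => /predU1P[->|/x_lt lt] // /lt /ltW.
    case: (ltngtP i j) => // [lt_ij|lt_ji].
      have := lt_le_trans lt_i (le_trans (x_le _ _ lt_ij lt_jn) le_j).
      by rewrite ltxx.
    have := lt_le_trans lt_j (le_trans (x_le _ _ lt_ji lt_in) le_i).
    by rewrite ltxx.
  have := cardC p; rewrite card_ord -/p.
  move: #|p| #|[predC p]| => m m' eq_m le_m.
  by rewrite subn2 -eq_m -subn1 leq_subLR add1n -addn1 leq_add2l.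

(* The point [E] between two consecutive zeros of [P] inside one gap of [G] *)
- case=> k [lt_k1n [lt_xz lt_zE lt_Ez lt_zx]].
  have lt_kn := ltnW lt_k1n.
  have dk : (d k <= k)%N by rewrite -z_gt.
  have dk1 : (k.+2 <= d k.+1)%N by rewrite -z_lt.
  have lt_xE := lt_trans lt_xz lt_zE; have lt_Ex := lt_trans lt_Ez lt_zx.
  have low i : (i <= k)%N -> (E < x`_i) = false.
    rewrite leq_eqVlt => /predU1P[->|lt_ik]; first by rewrite ltNge ltW.
    by rewrite ltNge ltW // (lt_trans (x_lt _ _ lt_ik lt_kn)).
  have high i : (k < i)%N -> (i < n)%N -> E < x`_i.
    rewrite leq_eqVlt => /predU1P[<-|lt_ki lt_in] //.
    exact: lt_trans (x_lt _ _ lt_ki lt_in).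
  (* Squeezed between [0 <= d 0] and [d k <= k]. *)
  have d_low i : (i <= k)%N -> d i = i.
    move=> le_ik; rewrite -[RHS]addn0; apply: (@steps_eq d 0 0 k) => //; last by rewrite addn0.
    move=> l /andP[_ lt_lk]; apply: d_step; first exact: leq_ltn_trans lt_kn.
    by rewrite !low // ltnW.
  (* Squeezed between [k.+2 <= d k.+1] and [d n.-1 <= n]: past [E] the count is shifted by one. *)
  have d_high i : (k < i)%N -> (i < n)%N -> d i = i.+1.
    move=> lt_ki lt_in; rewrite -[RHS]addn1; apply: (@steps_eq d 1 k.+1 n.-1).
    - by rewrite lt_ki -ltnS prednK.
    - move=> l /andP[lt_kl]; rewrite ltn_predRL => lt_ln.
      by apply: d_step => //; rewrite !high // ltnW.
    - by rewrite addn1.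
    - by rewrite addn1 prednK.
  (* The zeros of [(X - E) G]: since [x_k < E < x_(k+1)], [E] takes index [k.+1]. *)
  pose w := take k.+1 x ++ E :: drop k.+1 x.
  have size_w : size w = n.+1 by rewrite size_insert size_x.
  have w_nth i : w`_i =
      if (i < k.+1)%N then x`_i else if i == k.+1 then E else x`_i.-1.
    by rewrite nth_insert ?size_x.
  (* The comparisons of [E] with [z_k] and [z_(k+1)] are hypotheses; away from [E] the values of [d]
     decide. *)
  have inter_w i : (i < n)%N -> w`_i < z`_i < w`_i.+1.
    move=> lt_in; rewrite !w_nth !ltnS eqSS /=.
    have [lt_ik|lt_ki|->] := ltngtP i k; last by rewrite lt_xz.
      by rewrite z_gt // z_lt // !d_low ?leqnn ?ltnSn // ltnW.
    rewrite z_lt // d_high // ltnSn andbT.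
    case: eqP => [->|neq_ik] //.
    case: i lt_in lt_ki neq_ik => // i lt_in lt_ki neq_ik /=.
    have lt_ki1 : (k < i)%N.
      rewrite ltn_neqAle -ltnS lt_ki andbT.
      by apply/eqP => eq_k; case: neq_ik; rewrite eq_k.
    by rewrite z_gt ?d_high // ltnW.
  have sorted_w : sorted <%R w.
    apply: strict_sorted_nth => i; rewrite size_w ltnS => /inter_w/andP[].
    exact: lt_trans.
  (* The zeros of [P] are simple because an entry of [w] separates any two consecutive ones. *)
  have sorted_lt_z : sorted <%R z.
    apply: strict_sorted_nth => i; rewrite size_z => lt_in.
    have /andP[_ lt_zw] := inter_w i (ltnW lt_in).
    by have /andP[/(lt_trans lt_zw)] := inter_w i.+1 lt_in.
  exists w, z; split=> //; last first.
    by right; rewrite size_w size_z.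
  split=> //; apply: zeros_of_mul_XsubC => //; first by rewrite cat_take_drop.
  by apply: sub_sorted sorted_w => u v /ltW.

(* The point [E] outside the range of the zeros of [G] *)
- split=> lt_E.
  + have high i : (i < n)%N -> E < x`_i.
      by case: i => // i lt_in; apply: (lt_trans lt_E); apply: x_lt.
    (* Here [d 0] is odd, hence at least 1, and [d n.-1 <= n]; this forces the shift by one. *)
    have d_eq i : (i < n)%N -> d i = i.+1.
      move=> lt_in; rewrite -[RHS]addn1; apply: (@steps_eq d 1 0 n.-1).
      - by rewrite leq0n -ltnS prednK.
      - move=> l /=; rewrite ltn_predRL => lt_ln.
        by apply: d_step => //; rewrite !high // ltnW.
      - by have := odd_d 0%N n_ge1; rewrite high //; case: (d 0%N).
      - by rewrite addn1 prednK.
    have lt_zx i : (i < n)%N -> z`_i < x`_i by move=> ?; rewrite z_lt ?d_eq.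
    have lt_xz i : (i.+1 < n)%N -> x`_i < z`_i.+1.
      by move=> lt_in; rewrite z_gt ?d_eq // ltnW.
    exists z, x; split=> //; last by left; rewrite size_z size_x.
    split=> //; apply: strict_sorted_nth => i; rewrite size_z => lt_in.
    exact: lt_trans (lt_zx i (ltnW lt_in)) (lt_xz i lt_in).
  + have low i : (i < n)%N -> (E < x`_i) = false.
      move=> lt_in; rewrite ltNge ltW //.
      have : (i <= n.-1)%N by rewrite -ltnS prednK.
      rewrite leq_eqVlt => /predU1P[->|lt_i] //.
      by apply: lt_trans lt_E; apply: x_lt; rewrite // prednK.
    (* Here [d n.-1] has the parity of [n.-1], so it is not [n] and is at most [n.-1]; with
       [0 <= d 0] this leaves no shift. *)
    have d_eq i : (i < n)%N -> d i = i.
      move=> lt_in; rewrite -[RHS]addn0; apply: (@steps_eq d 0 0 n.-1) => //.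
      - by rewrite leq0n -ltnS prednK.
      - move=> l /=; rewrite ltn_predRL => lt_ln.
        by apply: d_step => //; rewrite !low // ltnW.
      - rewrite addn0 -ltnS prednK // ltn_neqAle d_le andbT.
        have lt_n1 : (n.-1 < n)%N by rewrite prednK.
        apply/eqP => d_n; have := odd_d n.-1 lt_n1.
        by rewrite low // addbF d_n -{1}(prednK n_ge1) /=; case: odd.
    have lt_xz i : (i < n)%N -> x`_i < z`_i by move=> ?; rewrite z_gt ?d_eq.
    have lt_zx i : (i.+1 < n)%N -> z`_i < x`_i.+1.
      by move=> lt_in; rewrite z_lt ?d_eq // ltnW.
    exists x, z; split=> //; last by left; rewrite size_z size_x.
    split=> //; apply: strict_sorted_nth => i; rewrite size_z => lt_in.
    exact: lt_trans (lt_zx i lt_in) (lt_xz i.+1 lt_in).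
Qed.
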